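(* Consider an operational probabilistic theory (OPT) satisfying Property ($\diamondsuit$) and the local equality postulate, with matrix representations $\mathcal M^A:\mathbf V_A\to\mathbf M_A$ of all systems fixed as in the context. Let $A,B$ be systems and let $\mathcal L:\mathbf{Proc}_{A\to B}\ni f\mapsto\mathcal L_f\in\mathbf{CP}_{A\to B}$ be an isomorphism (of convex cones) satisfying $\mathcal M^B_{f\circ|\rho)}=\mathcal L_f[\mathcal M^A_{|\rho)}]$ for all $f\in\mathbf{Proc}_{A\to B}$ and $|\rho)\in\mathbf{St}_A$. Then $f\in\mathbf{Proc}_{A\to B}$ is deterministic if and only if $\mathcal L_f$ is a trace-preserving CP map. Also, $f\in\mathbf{Proc}_{A\to B}$ is feasible if and only if $\mathcal L_f$ is a trace non-increasing CP map.
   Context: OPT. An operational theory is a strict symmetric monoidal category: objects are systems (unit: the trivial system $I$), morphisms are processes, $\mathbf{Proc}_{A\to B}$ is the set of processes from $A$ to $B$, with sequential composition $g\circ f$, parallel composition $A\otimes B$, $f\otimes g$, identities $\mathrm{id}_A$ and swaps. States: $\mathbf{St}_A:=\mathbf{Proc}_{I\to A}\ni|\rho)$; effects: $\mathbf{Eff}_A:=\mathbf{Proc}_{A\to I}\ni(e|$; scalars: $\mathbf{Proc}_{I\to I}$; $(e|\rho):=(e|\circ|\rho)$; $af:=a\otimes f$ for a scalar $a$. A diagram $u:\mathbf{Proc}_{A\to B}\to\mathbf{Proc}_{C\to D}$ is a map $u(f)=u_2\circ(f\otimes\mathrm{id}_E)\circ u_1$ for some system $E$ and processes $u_1\in\mathbf{Proc}_{C\to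 A\otimes E}$, $u_2\in\mathbf{Proc}_{B\otimes E\to D}$. An OPT is an operational theory with, for all $A,B$, a collection of tests (finite families of processes from $A$ to $B$). A process $f$ is deterministic if $\{f\}$ is a test, and feasible if it belongs to some test; a measurement of $A$ is a test from $A$ to $I$. Assumptions: (1) every system has a deterministic state and a deterministic effect; sequential and parallel compositions of tests (all pairwise composites) are tests. (2) The scalars are $\mathbb R_{\ge0}$, the feasible scalars are $[0,1]$, composition of scalars is multiplication, $\mathrm{id}_I=1$, and every process is $af$ with $a\ge0$ and $f$ feasible. (3) The deterministic effect $(\top_A|$ of each $A$ is unique, $(\top_{A\otimes B}|=(\top_A|\otimes(\top_B|$, and a finite family $\{f_j\}$ in $\mathbf{Proc}_{A\to B}$ is a test iff $\sum_j(\top_{B\otimes E}|\circ(f_j\otimes\mathrm{id}_E)\circ|\sigma)=(\top_{A\otimes E}|\sigma)$ for all $E$ and $|\sigma)\in\mathbf{St}_{A\otimes E}$. (4) $f,f'\in\mathbf{Proc}_{A\to B}$ are equal iff $u(f)=u(f')$ for all scalar-valued diagrams $u$. (5) For feasible $g_1,g_2\in\mathbf{Proc}_{A\to B}$ and $p\in[0,1]$ there is a feasible $h$ with $u(h)=p\,u(g_1)+(1-p)u(g_2)$ for all scalar-valued diagrams $u$. Hence each $\mathbf{Proc}_{A\to B}$ is a convex cone, with sums determined by $u(f_1+f_2)=u(f_1)+u(f_2)$. (6) The real vector space $\mathbf V_{A\to B}$ spanned by $\mathbf{Proc}_{A\to B}$ (formal real combinations, identified when all scalar-valued diagrams agree)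 is finite-dimensional. Put $\mathbf V_A:=\mathbf V_{I\to A}$, $\mathbf V_A^*:=\mathbf V_{A\to I}$, the latter being the dual space of $\mathbf V_A$; compositions extend bilinearly. (7) The set of normalized states $\mathbf{St}^{\mathrm N}_A:=\{|\rho)\in\mathbf{St}_A:(\top_A|\rho)=1\}$ is closed. Local equality postulate: if $f,f'\in\mathbf{Proc}_{A\to B}$ satisfy $(e|\circ f\circ|\rho)=(e|\circ f'\circ|\rho)$ for all $|\rho)\in\mathbf{St}_A$, $(e|\in\mathbf{Eff}_B$, then $f=f'$. Property ($\diamondsuit$): for each system $A$, $\mathbf{St}_A$ is a symmetric cone in $\mathbf V_A$ and $\mathbf{Eff}_A=\mathbf{St}_A^*:=\{(e|\in\mathbf V_A^*:(e|\rho)\ge0\ \forall|\rho)\in\mathbf{St}_A\}$. A cone $\mathcal C$ in $\mathbf V$ is symmetric if it is self-dual ($\mathcal C=\{x\in\mathbf V:\langle x,y\rangle\ge0\ \forall y\in\mathcal C\}$ for some inner product) and homogeneous (for any interior points $x,y$ there is a linear automorphism of $\mathcal C$ mapping $x$ to $y$). Here $x\in\mathcal C$ is an interior point if for every $y\in\mathcal C$ there is $\delta>0$ with $x-\delta y\in\mathcal C$. Matrix representations. In such an OPT, $\mathbf{St}_A\cong\bigoplus_{i=1}^{k_A}\mathcal S_+(\mathbb C^{n_i})$ for each $A$, where $\mathcal S_+(\mathbb C^n)$ is the cone of complex positive semidefinite $n\times n$ matrices and $\mathcal S(\mathbb C^n)$ denotes the complex Hermitian $n\times n$ matrices; put $N_A=\sum_in_i$.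 For each $A$ there is fixed a set of mutually orthogonal projection matrices $\mathcal P_A=\{P_{A,i}\}_{i=1}^{k_A}$ of order $N_A$ with $\mathrm{rank}\,P_{A,i}=n_i$ (so $\sum_iP_{A,i}$ is the identity matrix). Let $\mathbf M_A:=\{\sum_iH_i: H_i\in\mathcal S(\mathbb C^{N_A}),\ P_{A,i}H_iP_{A,i}=H_i\}$ and let $\mathbf M_A^+$ be the set of positive semidefinite matrices in $\mathbf M_A$. $\mathcal M^A:\mathbf V_A\to\mathbf M_A$, $|x)\mapsto\mathcal M^A_{|x)}$, is a linear isomorphism with $\mathcal M^A(\mathbf{St}_A)=\mathbf M_A^+$ and $\mathrm{Tr}\,\mathcal M^A_{|x)}=(\top_A|x)$ for all $|x)\in\mathbf V_A$. The choices are compatible with composition: $\mathcal P_{A\otimes B}=\{P_{A,i}\otimes P_{B,j}\}_{i,j}$ and $\mathcal M^{A\otimes B}_{|x)\otimes|y)}=\mathcal M^A_{|x)}\otimes\mathcal M^B_{|y)}$ (Kronecker product) for all systems $A,B$, $|x)\in\mathbf V_A$, $|y)\in\mathbf V_B$. $\mathbf{CP}_{A\to B}$ is the convex cone of completely positive (CP) linear maps from $\mathbf M_A$ to $\mathbf M_B$. Such a map $c$ is trace-preserving (resp. trace non-increasing) if $\mathrm{Tr}\,c(H)=\mathrm{Tr}\,H$ (resp. $\le\mathrm{Tr}\,H$) for all $H\in\mathbf M_A^+$. *)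

(* Defs.v *)
From HB Require Import structures.
From mathcomp Require Import all_boot all_order all_algebra.
From mathcomp Require Import complex mxtens.
From mathcomp Require Import boolp classical_sets reals topology normedtype.
From mathcomp Require Import sesquilinear spectral.

Set Implicit Arguments.
Unset Strict Implicit.
Unset Printing Implicit Defensive.

Import Order.TTheory GRing.Theory Num.Theory.
Import numFieldNormedType.Exports.

Local Open Scope classical_set_scope.
Local Open Scope complex_scope.
Local Open Scope sesquilinear_scope.
Local Open Scope ring_scope.

Declare Scope proc_scope.
Delimit Scope proc_scope with proc.
Local Open Scope proc_scope.

(* Strictness of the monoidal product is an equality between objects, so the
   laws relating processes with equal but not convertible (co)domains are
   stated through this transport, in the style of [castmx]. *)
Definition castp (S : Type) (P : S -> S -> Type) (A A' B B' : S)
    (eA : A = A') (eB : B = B') (f : P A B) : P A' B' :=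
  match eA in _ = X, eB in _ = Y return P X Y with
  | erefl, erefl => f
  end.
Arguments castp {S} P {A A' B B'} eA eB f.

(* Operational theories: strict symmetric monoidal categories.  The coherence
   [swap A triv = idp A] follows from [swap_hexagon] and [swapK]. *)
Record opTheory := OpTheory {
  sys : Type;
  proc : sys -> sys -> Type;
  idp : forall A, proc A A;
  pcomp : forall A B C, proc B C -> proc A B -> proc A C;
  triv : sys;
  tens : sys -> sys -> sys;
  ppar : forall A A' B B',
    proc A B -> proc A' B' -> proc (tens A A') (tens B B');
  swap : forall A B, proc (tens A B) (tens B A);

  pcompA : forall A B C D (h : proc C D) (g : proc B C) (f : proc A B),
    pcomp h (pcomp g f) = pcomp (pcomp h g) f;
  pcomp1p : forall A B (f : proc A B), pcomp (idp B) f = f;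
  pcompp1 : forall A B (f : proc A B), pcomp f (idp A) = f;

  ppar1 : forall A B, ppar (idp A) (idp B) = idp (tens A B);
  ppar_comp : forall A B C A' B' C' (g : proc B C) (f : proc A B)
      (g' : proc B' C') (f' : proc A' B'),
    ppar (pcomp g f) (pcomp g' f') = pcomp (ppar g g') (ppar f f');

  tensA : forall A B C, tens A (tens B C) = tens (tens A B) C;
  tens1s : forall A, tens triv A = A;
  tenss1 : forall A, tens A triv = A;
  pparA : forall A B C A' B' C'
      (f : proc A A') (g : proc B B') (h : proc C C'),
    castp proc (tensA A B C) (tensA A' B' C') (ppar f (ppar g h))
    = ppar (ppar f g) h;
  ppar1p : forall A B (f : proc A B),
    castp proc (tens1s A) (tens1s B) (ppar (idp triv) f) = f;
  pparp1 : forall A B (f : proc A B),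
    castp proc (tenss1 A) (tenss1 B) (ppar f (idp triv)) = f;

  swap_nat : forall A B A' B' (f : proc A B) (g : proc A' B'),
    pcomp (swap B B') (ppar f g) = pcomp (ppar g f) (swap A A');
  swapK : forall A B, pcomp (swap B A) (swap A B) = idp (tens A B);
  swap_hexagon : forall A B C,
    castp proc (tensA A B C) (esym (tensA B C A)) (swap A (tens B C))
    = pcomp (ppar (idp B) (swap A C))
        (castp proc erefl (esym (tensA B A C)) (ppar (swap A B) (idp C)))
}.

Arguments proc {o} _ _.
Arguments idp {o} A.
Arguments pcomp {o A B C} g f : rename.
Arguments triv {o}.
Arguments tens {o} _ _.
Arguments ppar {o A A' B B'} f g : rename.
Arguments swap {o} A B.
Arguments tensA {o} A B C.
Arguments tens1s {o} A.
Arguments tenss1 {o} A.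

Notation "A \os B" := (tens A B)
  (at level 40, left associativity) : proc_scope.
Notation "f \ox g" := (ppar f g)
  (at level 40, left associativity) : proc_scope.
Notation "g \oc f" := (pcomp g f)
  (at level 50, left associativity) : proc_scope.

Definition state (T : opTheory) (A : sys T) := proc triv A.
Definition effect (T : opTheory) (A : sys T) := proc A triv.
Definition scalar (T : opTheory) := @proc T triv triv.

Definition stens (T : opTheory) (A B : sys T) (r : state A) (s : state B) :
  state (A \os B) := castp proc (tens1s triv) erefl (r \ox s).

Definition etens (T : opTheory) (A B : sys T) (e : effect A) (d : effect B) :
  effect (A \os B) := castp proc erefl (tens1s triv) (e \ox d).

Definition pscale (T : opTheory) (A B : sys T) (a : scalar T) (f : proc A B) :
  proc A B := castp proc (tens1s A) (tens1s B) (a \ox f).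

Record diagram (T : opTheory) (A B C D : sys T) := Diagram {
  anc : sys T;
  pre : proc C (A \os anc);
  post : proc (B \os anc) D
}.

Definition dapp (T : opTheory) (A B C D : sys T) (u : diagram A B C D)
    (f : proc A B) : proc C D :=
  post u \oc (f \ox idp (anc u)) \oc pre u.

Definition sdiagram (T : opTheory) (A B : sys T) := diagram A B triv triv.

(* [scval] is the identification of the scalars with nonnegative reals; the
   tests are families indexed by arbitrary finite types. *)
Record optData (R : realType) := OptData {
  opth :> opTheory;
  scval : scalar opth -> R;
  test : forall (A B : sys opth) (J : finType), (J -> proc A B) -> Prop
}.
Arguments scval {R o} _.
Arguments test {R o A B J} _.

Section OptNotions.
Variables (R : realType) (T : optData R).
Implicit Types A B : sys T.

Definition deterministic A B (f : proc A B) : Prop :=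
  test (fun _ : unit => f).

Definition feasible A B (f : proc A B) : Prop :=
  exists (J : finType) (F : J -> proc A B) (j : J), test F /\ F j = f.

Definition uval A B (u : sdiagram A B) (f : proc A B) : R :=
  scval (dapp u f).

(* Value of a formal real linear combination on a scalar-valued diagram. *)
Definition fval A B (u : sdiagram A B) (s : seq (R * proc A B)) : R :=
  \sum_(p <- s) p.1 * uval u p.2.

End OptNotions.

(* Canonical topology of a finite-dimensional real vector space, read off in
   coordinates. *)
Definition vclosed (R : realType) (V : vectType R) (C : set V) : Prop :=
  closed [set \row_j coord (vbasis (fullv : {vspace V})) j x | x in C].

Record opt (R : realType) := Opt {
  optd :> optData R;

  det_state_ex : forall A : sys optd, exists r : state A, deterministic r;
  test_comp : forall (A B C : sys optd) (J K : finType)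
      (F : J -> proc A B) (G : K -> proc B C),
    test F -> test G -> test (fun jk : J * K => G jk.2 \oc F jk.1);
  test_par : forall (A B A' B' : sys optd) (J K : finType)
      (F : J -> proc A B) (G : K -> proc A' B'),
    test F -> test G -> test (fun jk : J * K => F jk.1 \ox G jk.2);

  scval_inj : injective (@scval R optd);
  scval_range : forall a : R, 0 <= a <-> exists s : scalar optd, scval s = a;
  scval_feasible : forall s : scalar optd, feasible s <-> 0 <= scval s <= 1;
  scval_comp : forall s t : scalar optd, scval (s \oc t) = scval s * scval t;
  scval_id : scval (idp (@triv optd)) = 1;
  proc_scale : forall (A B : sys optd) (f : proc A B),
    exists (a : scalar optd) (g : proc A B), feasible g /\ f = pscale a g;

  dtop : forall A : sys optd, effect A;
  dtopP : forall (A : sys optd) (e : effect A), deterministic e <-> e = dtop A;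
  dtop_tens : forall A B : sys optd, dtop (A \os B) = etens (dtop A) (dtop B);
  testP : forall (A B : sys optd) (J : finType) (F : J -> proc A B),
    test F <->
    forall (E : sys optd) (s : state (A \os E)),
      \sum_(j : J) scval (dtop (B \os E) \oc (F j \ox idp E) \oc s)
      = scval (dtop (A \os E) \oc s);

  proc_eqP : forall (A B : sys optd) (f g : proc A B),
    f = g <-> forall u : sdiagram A B, dapp u f = dapp u g;

  feasible_convex : forall (A B : sys optd) (g1 g2 : proc A B) (p : R),
    feasible g1 -> feasible g2 -> 0 <= p <= 1 ->
    exists h : proc A B, feasible h /\
      forall u : sdiagram A B,
        uval u h = p * uval u g1 + (1 - p) * uval u g2;

  (* The space spanned by the processes from [A] to [B]: generated by them, two
     formal combinations being identified iff all scalar-valued diagrams agree.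
     This determines [vsp A B] up to a unique isomorphism compatible with
     [emb]. *)
  vsp : forall A B : sys optd, vectType R;
  emb : forall A B : sys optd, proc A B -> vsp A B;
  emb_span : forall (A B : sys optd) (x : vsp A B),
    exists s : seq (R * proc A B), x = \sum_(p <- s) p.1 *: emb p.2;
  emb_eqP : forall (A B : sys optd) (s t : seq (R * proc A B)),
    \sum_(p <- s) p.1 *: emb p.2 = \sum_(p <- t) p.1 *: emb p.2 <->
    forall u : sdiagram A B, fval u s = fval u t;

  states_closed : forall A : sys optd,
    vclosed [set emb r | r in [set r : state A | scval (dtop A \oc r) = 1]]
}.

Arguments dtop {R o} A.
Arguments vsp {R o} A B.
Arguments emb {R o A B} f : rename.

Section CastTheory.
Variable T : opTheory.

Lemma castp_comp (A A' B B' C C' : sys T) (eA : A = A') (eB : B = B')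
    (eC : C = C') (g : proc B C) (f : proc A B) :
  castp proc eA eC (g \oc f) = castp proc eB eC g \oc castp proc eA eB f.
Proof. by case: A' / eA; case: B' / eB; case: C' / eC. Qed.

Lemma castp_mid (A B B' C D D' : sys T) (eB : B = B') (eD : D = D')
    (g : proc D' C) (h : proc B D) (f : proc A B') :
  g \oc castp proc eB eD h \oc f
  = castp proc (esym eD) erefl g \oc h \oc castp proc erefl (esym eB) f.
Proof. by case: B' / eB f; case: D' / eD g. Qed.

Lemma castp_ext (A A' B B' C C' D D' : sys T)
    (eA : A = A') (eB : B = B') (eC : C = C') (eD : D = D')
    (u : diagram A' B' C' D') :
  exists v : diagram A B C D, forall f : proc A B,
    dapp u (castp proc eA eB f) = castp proc eC eD (dapp v f).
Proof.
case: A' / eA u; case: B' / eB; case: C' / eC; case: D' / eD => u.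
by exists u.
Qed.

Lemma pscaleE (s t : scalar T) : pscale s t = s \oc t.
Proof.
have hs : castp proc (tens1s triv) (tens1s triv) (s \ox idp triv) = s.
  by rewrite (Prop_irrelevance (tens1s triv) (tenss1 triv)) pparp1.
rewrite -[in RHS]hs -[in RHS](ppar1p t) -castp_comp -ppar_comp.
by rewrite pcompp1 pcomp1p.
Qed.

Lemma dapp_scale (A B C D : sys T) (u : diagram A B C D) (a : scalar T)
    (f : proc A B) :
  dapp u (pscale a f) = pscale a (dapp u f).
Proof.
have par_cast (X X' Y Y' E : sys T) (eX : X = X') (eY : Y = Y') (h : proc X Y) :
    castp proc eX eY h \ox idp E
    = castp proc (congr1 (fun Z => Z \os E) eX) (congr1 (fun Z => Z \os E) eY)
        (h \ox idp E).
  by case: X' / eX; case: Y' / eY.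
have castpp (X X' X'' Y Y' Y'' : sys T) (e1 : X = X') (e2 : X' = X'')
    (e3 : Y = Y') (e4 : Y' = Y'') (h : proc X Y) :
    castp proc e2 e4 (castp proc e1 e3 h)
    = castp proc (etrans e1 e2) (etrans e3 e4) h.
  by case: X'' / e2; case: Y'' / e4; case: X' / e1; case: Y' / e3.
rewrite /dapp; set E := anc u.
have -> : pscale a f \ox idp E = pscale a (f \ox idp E).
  rewrite /pscale par_cast -pparA castpp.
  by congr (castp proc _ _ _); apply: Prop_irrelevance.
have {1}-> : post u = castp proc (tens1s _) (tens1s _) (idp triv \ox post u).
  by rewrite ppar1p.
have {1}-> : pre u = castp proc (tens1s _) (tens1s _) (idp triv \ox pre u).
  by rewrite ppar1p.
rewrite /pscale -castp_comp -castp_comp -!ppar_comp.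
by rewrite pcompp1 pcomp1p.
Qed.

Lemma dapp_comp_l (A B B' C D : sys T) (g : proc B B') (u : diagram A B' C D) :
  exists v : diagram A B C D, forall f, dapp u (g \oc f) = dapp v f.
Proof.
exists (Diagram (pre u) (post u \oc (g \ox idp (anc u)))) => f.
by rewrite /dapp /= -[idp (anc u) in LHS]pcomp1p ppar_comp !pcompA.
Qed.

Lemma dapp_comp_r (A A' B C D : sys T) (f : proc A A') (u : diagram A B C D) :
  exists v : diagram A' B C D, forall g, dapp u (g \oc f) = dapp v g.
Proof.
exists (Diagram ((f \ox idp (anc u)) \oc pre u) (post u)) => g.
by rewrite /dapp /= -[idp (anc u) in LHS]pcomp1p ppar_comp !pcompA.
Qed.

Lemma dapp_par_l (A B A' B' C D : sys T) (g : proc A' B')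
    (u : diagram (A \os A') (B \os B') C D) :
  exists v : diagram A B C D, forall f, dapp u (f \ox g) = dapp v f.
Proof.
case: u => E u1 u2.
pose u1' := castp proc erefl (esym (tensA A A' E)) u1.
pose u2' := castp proc (esym (tensA B B' E)) erefl u2.
exists (@Diagram T A B C D (B' \os E) ((idp A \ox (g \ox idp E)) \oc u1') u2').
move=> f; rewrite /dapp /= -pparA castp_mid -/u1' -/u2'.
rewrite pcompA -[u2' \oc _ \oc (idp A \ox _)]pcompA -ppar_comp.
by rewrite pcompp1 pcomp1p.
Qed.

Lemma dapp_par_r (A B A' B' C D : sys T) (f : proc A B)
    (u : diagram (A \os A') (B \os B') C D) :
  exists v : diagram A' B' C D, forall g, dapp u (f \ox g) = dapp v g.
Proof.
have swapE (g : proc A' B') : f \ox g = swap B' B \oc (g \ox f) \oc swap A A'.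
  by rewrite -pcompA -swap_nat pcompA swapK pcomp1p.
have [v vP] := dapp_comp_r (swap A A') u.
have [w wP] := dapp_comp_l (swap B' B) v.
have [z zP] := dapp_par_l f w.
by exists z => g; rewrite swapE vP wP zP.
Qed.

End CastTheory.

Section OptTheory.
Variables (R : realType) (T : opt R).
Implicit Types A B C : sys T.

Lemma scval_ge0 (s : scalar T) : 0 <= scval s.
Proof. by apply/scval_range; exists s. Qed.

Lemma uval_scale A B (u : sdiagram A B) (a : scalar T) (f : proc A B) :
  uval u (pscale a f) = scval a * uval u f.
Proof. by rewrite /uval dapp_scale pscaleE scval_comp. Qed.

Lemma padd_subproof A B (f g : proc A B) :
  exists h : proc A B,
    forall u : sdiagram A B, uval u h = uval u f + uval u g.
Proof.
have [a [f' [ff ->]]] := proc_scale f.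
have [b [g' [fg ->]]] := proc_scale g.
have a0 := scval_ge0 a; have b0 := scval_ge0 b.
have [c cE] : exists c : scalar T, scval c = scval a + scval b.
  by apply/scval_range; rewrite addr_ge0.
have p01 : 0 <= scval a / (scval a + scval b) <= 1.
  rewrite divr_ge0 ?addr_ge0 //=.
  have [->|nz] := eqVneq (scval a + scval b) 0; first by rewrite invr0 mulr0.
  by rewrite ler_pdivrMr ?mul1r ?lerDl // lt_neqAle eq_sym nz addr_ge0.
have [h [_ hE]] := feasible_convex ff fg p01.
exists (pscale c h) => u; rewrite !uval_scale cE hE.
have [z|nz] := eqVneq (scval a + scval b) 0.
  move/eqP: (z); rewrite paddr_eq0 // => /andP[/eqP-> /eqP->].
  by rewrite addr0 !mul0r addr0.
rewrite mulrDr !mulrA mulrBr mulr1 !mulrA ![_ * _ / _]mulrAC divff // !mul1r.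
by rewrite [X in (X - _) * _]addrC addrK.
Qed.

(* Sum in the convex cone of processes; by [proc_eqP] it is characterized by
   [padd_uval]. *)
Definition padd A B (f g : proc A B) : proc A B :=
  proj1_sig (cid (padd_subproof f g)).

Lemma padd_uval A B (f g : proc A B) (u : sdiagram A B) :
  uval u (padd f g) = uval u f + uval u g.
Proof. exact: (proj2_sig (cid (padd_subproof f g)) u). Qed.

Definition lincomb A B (s : seq (R * proc A B)) : vsp A B :=
  \sum_(p <- s) p.1 *: emb p.2.

Definition vrepr A B (x : vsp A B) : seq (R * proc A B) :=
  proj1_sig (cid (emb_span x)).

Lemma vreprK A B (x : vsp A B) : lincomb (vrepr x) = x.
Proof. by rewrite /lincomb /vrepr; case: cid. Qed.

(* Bilinear extensions of the compositions, defined on representatives; see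
   [vcompE], [vstensE] and [vvalE] for the independence of the choices. *)
Definition vcomp A B C (y : vsp B C) (x : vsp A B) : vsp A C :=
  \sum_(q <- vrepr y) \sum_(p <- vrepr x) (q.1 * p.1) *: emb (q.2 \oc p.2).

Definition vstens A B (x : vsp triv A) (y : vsp triv B) : vsp triv (A \os B) :=
  \sum_(p <- vrepr x) \sum_(q <- vrepr y) (p.1 * q.1) *: emb (stens p.2 q.2).

Definition vval (x : vsp triv (@triv T)) : R :=
  \sum_(p <- vrepr x) p.1 * scval p.2.

(* The pairing (e|x) of a generalized effect with a generalized state. *)
Definition vpair A (e : vsp A triv) (x : vsp triv A) : R := vval (vcomp e x).

Lemma fval_map A B A' B' (F : proc A B -> proc A' B')
    (u : sdiagram A' B') (v : sdiagram A B) (s : seq (R * proc A B)) :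
  (forall f, dapp u (F f) = dapp v f) ->
  fval u [seq (p.1, F p.2) | p <- s] = fval v s.
Proof.
by move=> uv; rewrite /fval big_map; apply: eq_bigr => p _; rewrite /uval uv.
Qed.

Lemma lincomb_map A B A' B' (F : proc A B -> proc A' B')
    (s t : seq (R * proc A B)) :
  (forall u : sdiagram A' B', exists v : sdiagram A B,
     forall f, dapp u (F f) = dapp v f) ->
  lincomb s = lincomb t ->
  \sum_(p <- s) p.1 *: emb (F p.2) = \sum_(p <- t) p.1 *: emb (F p.2).
Proof.
move=> uF /emb_eqP st.
pose m (w : seq (R * proc A B)) := [seq (p.1, F p.2) | p <- w].
have mE w : \sum_(p <- w) p.1 *: emb (F p.2) = lincomb (m w).
  by rewrite /lincomb big_map.
rewrite !mE; apply/emb_eqP => u; have [v uv] := uF u.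
by rewrite !(fval_map _ uv).
Qed.

Lemma bilin_ext A B A' B' A'' B'' (F : proc A B -> proc A' B' -> proc A'' B'')
    (s s' : seq (R * proc A B)) (t t' : seq (R * proc A' B')) :
  (forall g (u : sdiagram A'' B''), exists v : sdiagram A B,
     forall f, dapp u (F f g) = dapp v f) ->
  (forall f (u : sdiagram A'' B''), exists v : sdiagram A' B',
     forall g, dapp u (F f g) = dapp v g) ->
  lincomb s = lincomb s' -> lincomb t = lincomb t' ->
  \sum_(p <- s) \sum_(q <- t) (p.1 * q.1) *: emb (F p.2 q.2)
  = \sum_(p <- s') \sum_(q <- t') (p.1 * q.1) *: emb (F p.2 q.2).
Proof.
move=> Fl Fr ss' tt'.
transitivity (\sum_(p <- s) \sum_(q <- t') (p.1 * q.1) *: emb (F p.2 q.2)).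
  apply: eq_bigr => p _.
  have E w : \sum_(q <- w) (p.1 * q.1) *: emb (F p.2 q.2)
             = p.1 *: \sum_(q <- w) q.1 *: emb (F p.2 q.2).
    by rewrite scaler_sumr; apply: eq_bigr => q _; rewrite scalerA.
  by rewrite !E (lincomb_map (Fr p.2) tt').
rewrite exchange_big [RHS]exchange_big; apply: eq_bigr => q _ /=.
have E w : \sum_(p <- w) (p.1 * q.1) *: emb (F p.2 q.2)
           = q.1 *: \sum_(p <- w) p.1 *: emb (F p.2 q.2).
  by rewrite scaler_sumr; apply: eq_bigr => p _; rewrite scalerA mulrC.
by rewrite !E (lincomb_map (Fl q.2) ss').
Qed.

Lemma vcompE A B C (t : seq (R * proc B C)) (s : seq (R * proc A B)) :
  vcomp (lincomb t) (lincomb s)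
  = \sum_(q <- t) \sum_(p <- s) (q.1 * p.1) *: emb (q.2 \oc p.2).
Proof.
apply: (@bilin_ext _ _ _ _ _ _ (fun q p => q \oc p)); rewrite ?vreprK //.
- by move=> f u; have [v] := dapp_comp_r f u; exists v.
- by move=> g u; have [v] := dapp_comp_l g u; exists v.
Qed.

Lemma vstensE A B (s : seq (R * state A)) (t : seq (R * state B)) :
  vstens (lincomb s) (lincomb t)
  = \sum_(p <- s) \sum_(q <- t) (p.1 * q.1) *: emb (stens p.2 q.2).
Proof.
apply: (@bilin_ext _ _ _ _ _ _ (@stens T A B)); rewrite ?vreprK //.
- move=> g u; have [v uv] := castp_ext (tens1s triv) erefl erefl erefl u.
  by have [w vw] := dapp_par_l g v; exists w => f; rewrite /stens uv vw.
- move=> f u; have [v uv] := castp_ext (tens1s triv) erefl erefl erefl u.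
  by have [w vw] := dapp_par_r f v; exists w => g; rewrite /stens uv vw.
Qed.

Lemma vvalE (s : seq (R * scalar T)) :
  vval (lincomb s) = \sum_(p <- s) p.1 * scval p.2.
Proof.
pose u : sdiagram (@triv T) triv :=
  Diagram (castp proc erefl (esym (tenss1 triv)) (idp triv))
          (castp proc (esym (tenss1 triv)) erefl (idp triv)).
have uE (a : scalar T) : dapp u a = a.
  have := castp_mid (tenss1 triv) (tenss1 triv) (idp triv)
    (a \ox idp triv) (idp triv).
  by rewrite /dapp /= => <-; rewrite pparp1 pcomp1p pcompp1.
have fE w : fval u w = \sum_(p <- w) p.1 * scval p.2.
  by apply: eq_bigr => p _; rewrite /uval uE.
rewrite /vval -!fE; have := vreprK (lincomb s).
by rewrite {1 3}/lincomb => /emb_eqP.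
Qed.

Lemma emb_lincomb A B (f : proc A B) : emb f = lincomb [:: (1, f)].
Proof. by rewrite /lincomb big_seq1 scale1r. Qed.

Lemma vcomp_emb A B C (g : proc B C) (f : proc A B) :
  vcomp (emb g) (emb f) = emb (g \oc f).
Proof. by rewrite !emb_lincomb vcompE !big_seq1 mulr1 -emb_lincomb scale1r. Qed.

Lemma vstens_emb A B (r : state A) (s : state B) :
  vstens (emb r) (emb s) = emb (stens r s).
Proof.
by rewrite !emb_lincomb vstensE !big_seq1 mulr1 -emb_lincomb scale1r.
Qed.

Lemma vpair_emb A (e : effect A) (r : state A) :
  vpair (emb e) (emb r) = scval (e \oc r).
Proof. by rewrite /vpair vcomp_emb emb_lincomb vvalE big_seq1 mul1r. Qed.

Lemma emb_padd A B (f g : proc A B) : emb (padd f g) = emb f + emb g.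
Proof.
have -> : emb f + emb g = lincomb [:: (1, f); (1, g)].
  by rewrite /lincomb big_cons big_seq1 !scale1r.
rewrite emb_lincomb; apply/emb_eqP => u.
by rewrite /fval big_seq1 big_cons big_seq1 !mul1r padd_uval.
Qed.

Lemma emb_pscale A B (a : scalar T) (f : proc A B) :
  emb (pscale a f) = scval a *: emb f.
Proof.
have -> : scval a *: emb f = lincomb [:: (scval a, f)].
  by rewrite /lincomb big_seq1.
rewrite emb_lincomb; apply/emb_eqP => u.
by rewrite /fval !big_seq1 mul1r uval_scale.
Qed.

Definition local_equality : Prop :=
  forall (A B : sys T) (f f' : proc A B),
    (forall (r : state A) (e : effect B), e \oc f \oc r = e \oc f' \oc r) ->
    f = f'.

End OptTheory.

Section SymmetricCones.
Variables (R : realType) (V : vectType R).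
Implicit Type C : set V.

Definition cone_interior C (x : V) : Prop :=
  C x /\ forall y, C y -> exists2 d : R, 0 < d & C (x - d *: y).

Definition self_dual C : Prop :=
  exists ip : {dot V for idfun}, C = [set x | forall y, C y -> 0 <= ip x y].

Definition homogeneous C : Prop :=
  forall x y, cone_interior C x -> cone_interior C y ->
    exists g : {linear V -> V}, [/\ bijective g, g @` C = C & g x = y].

Definition symmetric_cone C : Prop := self_dual C /\ homogeneous C.

End SymmetricCones.

Section Diamond.
Variables (R : realType) (T : opt R).

Definition state_cone (A : sys T) : set (vsp triv A) := range (@emb R T triv A).

Definition effect_cone (A : sys T) : set (vsp A triv) := range (@emb R T A triv).

Definition dual_cone (A : sys T) (C : set (vsp triv A)) : set (vsp A triv) :=
  [set e | forall x, C x -> 0 <= vpair e x].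

Definition diamond : Prop :=
  forall A : sys T, symmetric_cone (state_cone (A := A)) /\
    effect_cone (A := A) = dual_cone (state_cone (A := A)).

End Diamond.

Section MatrixNotions.
Variable R : realType.

Definition psdmx n (H : 'M[R[i]]_n) : Prop :=
  H \is hermsymmx /\ forall v : 'rV[R[i]]_n, 0 <= (v *m H *m v ^t*) 0 0.

Definition blockmx k n (P : 'I_k -> 'M[R[i]]_n) : set 'M[R[i]]_n :=
  [set H | exists2 F : 'I_k -> 'M[R[i]]_n,
     (forall i, F i \is hermsymmx /\ P i *m F i *m P i = F i) &
     H = \sum_i F i].

End MatrixNotions.

Local Notation "A *t B" := (tensmx A B) (at level 40, left associativity).

Record matrixRep (R : realType) (T : opt R) := MatrixRep {
  nblk : sys T -> nat;
  blk : forall A, 'I_(nblk A) -> nat;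
  ordm : sys T -> nat;
  prj : forall A, 'I_(nblk A) -> 'M[R[i]]_(ordm A);
  mrep : forall A, vsp triv A -> 'M[R[i]]_(ordm A);

  blk_gt0 : forall A (i : 'I_(nblk A)), (0 < blk i)%N;
  ordmE : forall A, ordm A = (\sum_(i < nblk A) blk i)%N;
  prj_herm : forall A (i : 'I_(nblk A)), prj i \is hermsymmx;
  prj_idem : forall A (i : 'I_(nblk A)), prj i *m prj i = prj i;
  prj_ortho : forall A (i j : 'I_(nblk A)), i != j -> prj i *m prj j = 0;
  prj_rank : forall A (i : 'I_(nblk A)), \rank (prj i) = blk i;

  mrep_lin : forall A (a : R) (x y : vsp triv A),
    mrep (a *: x + y) = a%:C *: mrep x + mrep y;
  mrep_inj : forall A, injective (@mrep A);
  mrep_range : forall A, range (@mrep A) = blockmx (@prj A);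
  mrep_state : forall A,
    @mrep A @` (@state_cone R T A) = [set H | blockmx (@prj A) H /\ psdmx H];
  mrep_tr : forall A (x : vsp triv A),
    \tr (mrep x) = (vpair (emb (dtop A)) x)%:C;

  ordm_tens : forall A B, ordm (A \os B) = (ordm A * ordm B)%N;
  prj_tens : forall A B,
    [set castmx (ordm_tens A B, ordm_tens A B) (prj k)
       | k in [set: 'I_(nblk (A \os B))]]
    = [set prj ij.1 *t prj ij.2 | ij in [set: 'I_(nblk A) * 'I_(nblk B)]];
  mrep_tens : forall A B (x : vsp triv A) (y : vsp triv B),
    castmx (ordm_tens A B, ordm_tens A B) (mrep (vstens x y))
    = mrep x *t mrep y
}.

Section CompletelyPositive.
Variables (R : realType) (T : opt R) (M : matrixRep T).
Implicit Types A B : sys T.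

Definition mspace A : set 'M[R[i]]_(ordm M A) := blockmx (@prj R T M A).

Definition mpos A : set 'M[R[i]]_(ordm M A) :=
  [set H | mspace H /\ psdmx H].

Definition lin_on A B (c : 'M[R[i]]_(ordm M A) -> 'M[R[i]]_(ordm M B)) : Prop :=
  (forall H, mspace H -> mspace (c H)) /\
  (forall (a : R) H K, mspace H -> mspace K ->
     c (a%:C *: H + K) = a%:C *: c H + c K).

(* The map c (x) id_m is positive for every m: each element of the tensor
   product of [mspace A] with the Hermitian matrices of order m is a finite sum
   of elementary tensors, on which the ampliation acts as below. *)
Definition positive_ampliations A B
    (c : 'M[R[i]]_(ordm M A) -> 'M[R[i]]_(ordm M B)) : Prop :=
  forall (m r : nat) (H : 'I_r -> 'M[R[i]]_(ordm M A)) (K : 'I_r -> 'M[R[i]]_m),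
    (forall j, mspace (H j)) -> (forall j, K j \is hermsymmx) ->
    psdmx (\sum_j H j *t K j) -> psdmx (\sum_j c (H j) *t K j).

(* Only the values on [mspace A] matter: two CP maps are the same when they
   agree there, see [cp_eq]. *)
Record cpMap A B := CPMap {
  cpfun :> 'M[R[i]]_(ordm M A) -> 'M[R[i]]_(ordm M B);
  cp_lin : lin_on cpfun;
  cp_pos : positive_ampliations cpfun
}.

Definition cp_eq A B (c d : cpMap A B) : Prop :=
  forall H, mspace H -> c H = d H.

Definition trace_preserving A B (c : cpMap A B) : Prop :=
  forall H, mpos H -> \tr (c H) = \tr H.

(* The order of [R[i]] compares real parts and requires equal imaginary parts;
   both traces are real here. *)
Definition trace_nonincreasing A B (c : cpMap A B) : Prop :=
  forall H, mpos H -> \tr (c H) <= \tr H.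

Definition cone_iso A B (L : proc A B -> cpMap A B) : Prop :=
  [/\ forall f g, cp_eq (L f) (L g) -> f = g,
      forall c : cpMap A B, exists f, cp_eq (L f) c,
      forall f g H, mspace H -> L (padd f g) H = L f H + L g H &
      forall (a : scalar T) f H, mspace H ->
        L (pscale a f) H = (scval a)%:C *: L f H].

End CompletelyPositive.

(* Main.v *)
(* Since [dtop (B \os E)] is the product of [dtop B] and [dtop E], a family
   [F] is a test iff the effects [dtop B \oc F j] sum to [dtop A].  The trace
   of [L f H], for [H] representing a state [r], is [(dtop B \oc f | r)], so
   trace conditions on [L f] compare [dtop B \oc f] with [dtop A] on states.
   If [dtop B \oc f <= dtop A] there, the difference lies in the dual of the
   state cone, hence is an effect [e], and [f] is completed to a test by
   applying [e] and then preparing a deterministic state of [B]. *)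
Require Import Defs.
From HB Require Import structures.
From mathcomp Require Import all_boot all_order all_algebra.
From mathcomp Require Import complex mxtens.
From mathcomp Require Import boolp classical_sets reals topology normedtype.

Set Implicit Arguments.
Unset Strict Implicit.
Unset Printing Implicit Defensive.

Import Order.TTheory GRing.Theory Num.Theory.

Local Open Scope ring_scope.
Local Open Scope proc_scope.

Lemma etens_comp (T : opTheory) (A A' B B' : sys T)
    (e : effect B) (d : effect B') (f : proc A B) (g : proc A' B') :
  etens e d \oc (f \ox g) = etens (e \oc f) (d \oc g).
Proof. by rewrite /etens ppar_comp (castp_comp erefl erefl). Qed.

Section Tests.
Variables (R : realType) (T : opt R).
Implicit Types A B E : sys T.

Lemma dtop_discard A B E (f : proc A B) (s : state (A \os E)) :
  dtop (B \os E) \oc (f \ox idp E) \oc s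
  = etens (dtop B \oc f) (dtop E) \oc s.
Proof. by rewrite dtop_tens etens_comp pcompp1. Qed.

(** Discarding the ancilla after [e] is a scalar-valued diagram in [e], so identities between
    effects that hold on all diagrams apply to the test criterion. *)
Lemma discard_diagram A E (s : state (A \os E)) :
  exists u : sdiagram A triv, forall e : effect A,
    uval u e = scval (etens e (dtop E) \oc s).
Proof.
exists (Diagram s (etens (idp triv) (dtop E))) => e.
by rewrite /uval /dapp /= etens_comp pcompp1 pcomp1p.
Qed.

Lemma dtop_triv : dtop (@triv T) = idp triv.
Proof.
apply/esym/dtopP/testP => E s; rewrite big_const card_unit /= addr0.
by rewrite dtop_discard pcompp1 -dtop_tens.
Qed.

(** The objects are kept general so that [eA] and [eB] can be eliminated; the use is
    [A' = A \os triv], which removes a trivial ancilla. *)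
Lemma dtop_unit_cast A B A' B' (eA : A' = A) (eB : B' = B)
    (h : proc A' B') (f : proc A B) (r : state A) :
  castp proc eA eB h = f ->
  dtop B' \oc h \oc castp proc erefl (esym eA) r = dtop B \oc f \oc r.
Proof. by case: A / eA f r; case: B / eB => f r /= ->. Qed.

Lemma test_sum A B (J : finType) (F : J -> proc A B) (r : state A) :
  test F -> \sum_j scval (dtop B \oc F j \oc r) = scval (dtop A \oc r).
Proof.
move=> /testP/(_ _ (castp proc erefl (esym (tenss1 A)) r)) FE.
have := dtop_unit_cast r (pparp1 (idp A)).
rewrite ppar1 !pcompp1 => <-; rewrite -FE; apply: eq_bigr => j _.
by rewrite (dtop_unit_cast r (pparp1 (F j))).
Qed.

Lemma deterministicP A B (f : proc A B) :
  deterministic f <-> dtop B \oc f = dtop A.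
Proof.
split=> [df|fE].
  apply/dtopP/testP => E s; rewrite big_const card_unit /= addr0.
  move/testP: df => /(_ E s); rewrite big_const card_unit /= addr0.
  (* By uniqueness of [dtop A] it suffices that [dtop B \oc f] is itself deterministic. *)
  by rewrite !dtop_discard dtop_triv pcomp1p.
by apply/testP => E s; rewrite big_const card_unit /= addr0 dtop_discard fE
  -dtop_tens.
Qed.

(** The effects [a] supplied by local equality act on the trivial system: they are scalars and
    factor out. *)
Lemma effect_ext A (e d : effect A) : local_equality T ->
  (forall r : state A, scval (e \oc r) = scval (d \oc r)) -> e = d.
Proof.
move=> Tloc ed; apply: Tloc => r a; apply: scval_inj.
by rewrite -!pcompA !scval_comp ed.
Qed.

Lemma vpair_embB A (e d : effect A) (r : state A) :
  vpair (emb e - emb d) (emb r) = scval (e \oc r) - scval (d \oc r).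
Proof.
have -> : emb e - emb d = lincomb [:: (1, e); (-1, d)].
  by rewrite /lincomb big_cons big_seq1 scale1r scaleN1r.
rewrite /vpair [emb r]emb_lincomb vcompE big_cons !big_seq1 !mulr1.
have -> : 1 *: emb (e \oc r) + -1 *: emb (d \oc r)
          = lincomb [:: (1, e \oc r); (-1, d \oc r)].
  by rewrite /lincomb big_cons big_seq1.
by rewrite vvalE big_cons big_seq1 mul1r mulN1r.
Qed.

(** The inequality puts [emb e - emb d] in the dual cone, which is the effect cone. The conclusion
    ranges over all diagrams because tests involve ancillas. *)
Lemma effect_complement A (e d : effect A) : diamond T ->
  (forall r : state A, scval (d \oc r) <= scval (e \oc r)) ->
  exists c : effect A, forall u : sdiagram A triv,
    uval u e = uval u c + uval u d.
Proof.
move=> Tdiam le_de.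
have : effect_cone (emb e - emb d).
  by rewrite (Tdiam A).2 => _ [r _ <-]; rewrite vpair_embB subr_ge0.
move=> [c _ cE]; exists c => u; rewrite -padd_uval.
have : emb e = emb (padd c d) by rewrite emb_padd cE subrK.
rewrite !emb_lincomb => /emb_eqP/(_ u).
by rewrite /fval !big_seq1 !mul1r.
Qed.

Lemma feasibleP A B (f : proc A B) : diamond T ->
  feasible f <->
  forall r : state A, scval (dtop B \oc f \oc r) <= scval (dtop A \oc r).
Proof.
move=> Tdiam; split=> [[J [F [j [FT <-]]]] r|le_f].
  rewrite -(test_sum r FT) (bigD1 j) //= lerDl.
  by apply: sumr_ge0 => k _; apply: scval_ge0.
have [c cE] := effect_complement Tdiam le_f.
have [r /deterministicP rE] := det_state_ex B.
exists bool, (fun b => if b then f else r \oc c), true; split=> //.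
apply/testP => E s; rewrite big_bool /= !dtop_discard pcompA rE dtop_triv.
(* Since [s] is a joint state with the ancilla, the complement identity is applied to the diagram
   built from [s]. *)
have [u uE] := discard_diagram s.
by rewrite pcomp1p dtop_tens -!uE cE addrC.
Qed.

End Tests.

Section Traces.
Variables (R : realType) (T : opt R) (M : matrixRep T) (A B : sys T).

Lemma mposP (H : 'M_(ordm M A)) :
  mpos H <-> exists r : state A, H = mrep M (emb r).
Proof.
rewrite -[mpos H]/([set K | blockmx (@prj R T M A) K /\ psdmx K]%classic H).
rewrite -mrep_state.
split=> [[_ [r _ <-] <-]|[r ->]]; first by exists r.
by exists (emb r) => //; exists r.
Qed.

Lemma mrep_emb_tr (C : sys T) (r : state C) :
  \tr (mrep M (emb r)) = (scval (dtop C \oc r))%:C%C.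
Proof. by rewrite mrep_tr vpair_emb. Qed.

Variables (f : proc A B) (c : cpMap M A B).
Hypothesis fc : forall r, mrep M (emb (f \oc r)) = c (mrep M (emb r)).

Lemma trace_preservingP :
  trace_preserving c <->
  forall r, scval (dtop B \oc f \oc r) = scval (dtop A \oc r).
Proof.
split=> [tp r|tp _ /mposP[r ->]].
  have /tp : mpos (mrep M (emb r)) by apply/mposP; exists r.
  (* Equality of embedded reals is read off on real parts. *)
  by rewrite -fc !mrep_emb_tr pcompA => -[].
by rewrite -fc !mrep_emb_tr pcompA tp.
Qed.

Lemma trace_nonincreasingP :
  trace_nonincreasing c <->
  forall r, scval (dtop B \oc f \oc r) <= scval (dtop A \oc r).
Proof.
split=> [tn r|tn _ /mposP[r ->]].
  have /tn : mpos (mrep M (emb r)) by apply/mposP; exists r.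
  by rewrite -fc !mrep_emb_tr pcompA lecR.
by rewrite -fc !mrep_emb_tr pcompA lecR.
Qed.

End Traces.

Theorem theorem45 (R : realType) (T : opt R)
    (T_diamond : diamond T) (T_local : local_equality T)
    (M : matrixRep T) (A B : sys T)
    (L : proc A B -> cpMap M A B)
    (L_iso : cone_iso L)
    (L_rep : forall (f : proc A B) (r : state A),
       mrep M (emb (f \oc r)) = L f (mrep M (emb r))) :
  (forall f : proc A B, deterministic f <-> trace_preserving (L f)) /\
  (forall f : proc A B, feasible f <-> trace_nonincreasing (L f)).
Proof.
split=> f.
  rewrite (trace_preservingP (L_rep f)).
  split=> [/deterministicP-> //|fE]; apply/deterministicP.
  (* Local equality lifts agreement on states of [A] alone to equality of effects, which covers
     ancillas. *)
  exact: effect_ext.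
rewrite (trace_nonincreasingP (L_rep f)).
exact: feasibleP.
Qed.
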